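(* Let $K$ be a field. For every positive integer $n$, $L_K(C_n^1)\cong \mathrm{M}_{2^n-1}(L_K(1,2^n))$ as $K$-algebras.
   Context: For a directed graph $E=(E^0,E^1,r,s)$ and a field $K$, the Leavitt path algebra $L_K(E)$ is the $K$-algebra generated by $\{v\mid v\in E^0\}\cup\{e,e^*\mid e\in E^1\}$ subject to: (V) $vw=\delta_{v,w}v$ for $v,w\in E^0$; (E1) $s(e)e=er(e)=e$; (E2) $r(e)e^*=e^*s(e)=e^*$; (CK1) $e^*e'=\delta_{e,e'}r(e)$ for $e,e'\in E^1$; (CK2) $v=\sum_{\{e\in E^1\mid s(e)=v\}}ee^*$ for every $v\in E^0$ with $0<|s^{-1}(v)|<\infty$. $C_n^1$ is the directed graph with $n$ vertices $v_1,\dots,v_n$ and $2n$ edges $e_1,\dots,e_n,f_1,\dots,f_n$, where both $e_i$ and $f_i$ go from $v_i$ to $v_{i+1}$ (subscripts mod $n$; for $n=1$ this is one vertex with two loops). The Leavitt algebra $L_K(1,m)$ ($m\ge 2$) is the free associative unital $K$-algebra in $2m$ generators $x_1,\dots,x_m,y_1,\dots,y_m$ modulo the relations $y_ix_k=\delta_{i,k}1_K$ and $\sum_{i=1}^m x_iy_i=1_K$. $\mathrm{M}_d(A)$ is the ring of $d\times d$ matrices over $A$. *)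

(* Defs.v *)
From HB Require Import structures.
From mathcomp Require Import all_boot all_order all_algebra.
From mathcomp Require Import boolp.

Set Implicit Arguments.
Unset Strict Implicit.
Unset Printing Implicit Defensive.

Import GRing.Theory.
Local Open Scope ring_scope.
Local Open Scope quotient_scope.

(** * Associative algebras presented by generators and relations

   Leavitt path algebras are presented in the category of associative algebras
   that need not have a unit, whereas L_K(1,m) is presented in the category of
   unital ones.  Both are instances of one construction, indexed by a boolean
   [b] saying whether a unit belongs to the signature: the constructor [TOne]
   is available only for [b = true]. *)

Inductive alg_term (K : Type) (b : bool) (X : Type) : Type :=
| TGen of X
| TZero
| TOne of b
| TAdd of alg_term K b X & alg_term K b X
| TOpp of alg_term K b X
| TScale of K & alg_term K b X
| TMul of alg_term K b X & alg_term K b X.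

Arguments TGen {K b X}.
Arguments TZero {K b X}.
Arguments TOne {K b X}.
Arguments TAdd {K b X}.
Arguments TOpp {K b X}.
Arguments TScale {K b X}.
Arguments TMul {K b X}.

HB.instance Definition _ (K : Type) (b : bool) (X : Type) :=
  gen_eqMixin (alg_term K b X).
HB.instance Definition _ (K : Type) (b : bool) (X : Type) :=
  gen_choiceMixin (alg_term K b X).

(* The least congruence containing the relations [R] and the axioms of
   associative K-algebras (unital ones when [b = true]). *)
Inductive alg_cong (K : comPzRingType) (b : bool) (X : Type)
    (R : alg_term K b X -> alg_term K b X -> Prop) :
    alg_term K b X -> alg_term K b X -> Prop :=
| cong_rel t u : R t u -> alg_cong R t u
| cong_refl t : alg_cong R t t
| cong_sym t u : alg_cong R t u -> alg_cong R u t
| cong_trans t u w : alg_cong R t u -> alg_cong R u w -> alg_cong R t w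
| cong_add t t' u u' : alg_cong R t t' -> alg_cong R u u' ->
    alg_cong R (TAdd t u) (TAdd t' u')
| cong_opp t t' : alg_cong R t t' -> alg_cong R (TOpp t) (TOpp t')
| cong_scale a t t' : alg_cong R t t' -> alg_cong R (TScale a t) (TScale a t')
| cong_mul t t' u u' : alg_cong R t t' -> alg_cong R u u' ->
    alg_cong R (TMul t u) (TMul t' u')
| cong_addA t u w : alg_cong R (TAdd t (TAdd u w)) (TAdd (TAdd t u) w)
| cong_addC t u : alg_cong R (TAdd t u) (TAdd u t)
| cong_add0 t : alg_cong R (TAdd TZero t) t
| cong_addN t : alg_cong R (TAdd (TOpp t) t) TZero
| cong_scaleA a c t :
    alg_cong R (TScale a (TScale c t)) (TScale (a * c) t)
| cong_scale1 t : alg_cong R (TScale 1 t) t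
| cong_scaleDr a t u :
    alg_cong R (TScale a (TAdd t u)) (TAdd (TScale a t) (TScale a u))
| cong_scaleDl a c t :
    alg_cong R (TScale (a + c) t) (TAdd (TScale a t) (TScale c t))
| cong_mulA t u w : alg_cong R (TMul t (TMul u w)) (TMul (TMul t u) w)
| cong_mulDl t u w :
    alg_cong R (TMul (TAdd t u) w) (TAdd (TMul t w) (TMul u w))
| cong_mulDr t u w :
    alg_cong R (TMul t (TAdd u w)) (TAdd (TMul t u) (TMul t w))
| cong_scaleAl a t u : alg_cong R (TMul (TScale a t) u) (TScale a (TMul t u))
| cong_scaleAr a t u : alg_cong R (TMul t (TScale a u)) (TScale a (TMul t u))
| cong_mul1l (h : b) t : alg_cong R (TMul (TOne h) t) t
| cong_mul1r (h : b) t : alg_cong R (TMul t (TOne h)) t.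

Section PresentedAlgebra.
Variables (K : comPzRingType) (b : bool) (X : Type).
Variable R : alg_term K b X -> alg_term K b X -> Prop.

Definition alg_congb : rel (alg_term K b X) := fun t u => `[< alg_cong R t u >].

Lemma alg_congb_refl : reflexive alg_congb.
Proof. by move=> t; apply/asboolP/cong_refl. Qed.

Lemma alg_congb_sym : symmetric alg_congb.
Proof. by move=> t u; apply/asboolP/asboolP; exact: cong_sym. Qed.

Lemma alg_congb_trans : transitive alg_congb.
Proof.
move=> u t w /asboolP tu /asboolP uw; apply/asboolP.
exact: cong_trans tu uw.
Qed.

Canonical alg_congb_equiv :=
  EquivRel alg_congb alg_congb_refl alg_congb_sym alg_congb_trans.

Definition presented_alg := {eq_quot alg_congb}.
HB.instance Definition _ := Choice.on presented_alg.
HB.instance Definition _ := EqQuotient.on presented_alg.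

Definition pres_class (t : alg_term K b X) : presented_alg := \pi t.

Lemma pres_classP t u : pres_class t = pres_class u <-> alg_cong R t u.
Proof.
split=> [/eqmodP /asboolP //|tu]; exact/eqmodP/asboolP.
Qed.

Lemma pres_class_repr (x : presented_alg) : pres_class (repr x) = x.
Proof. exact: reprK. Qed.

Lemma pres_cong_repr t : alg_cong R (repr (pres_class t)) t.
Proof. exact/pres_classP/pres_class_repr. Qed.

Lemma pres_ind (P : presented_alg -> Prop) :
  (forall t, P (pres_class t)) -> forall x, P x.
Proof. by move=> Pt x; rewrite -(pres_class_repr x). Qed.

Definition pres_gen (x : X) := pres_class (TGen x).
Definition pres_zero := pres_class TZero.
Definition pres_add (x y : presented_alg) := pres_class (TAdd (repr x) (repr y)).
Definition pres_opp (x : presented_alg) := pres_class (TOpp (repr x)).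
Definition pres_scale (a : K) (x : presented_alg) :=
  pres_class (TScale a (repr x)).
Definition pres_mul (x y : presented_alg) := pres_class (TMul (repr x) (repr y)).

Lemma pres_addE t u :
  pres_add (pres_class t) (pres_class u) = pres_class (TAdd t u).
Proof. by apply/pres_classP; apply: cong_add; apply: pres_cong_repr. Qed.

Lemma pres_oppE t : pres_opp (pres_class t) = pres_class (TOpp t).
Proof. by apply/pres_classP; apply: cong_opp; apply: pres_cong_repr. Qed.

Lemma pres_scaleE a t : pres_scale a (pres_class t) = pres_class (TScale a t).
Proof. by apply/pres_classP; apply: cong_scale; apply: pres_cong_repr. Qed.

Lemma pres_mulE t u :
  pres_mul (pres_class t) (pres_class u) = pres_class (TMul t u).
Proof. by apply/pres_classP; apply: cong_mul; apply: pres_cong_repr. Qed.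

Let presE := (pres_addE, pres_oppE, pres_scaleE, pres_mulE).

Fact pres_addA : associative pres_add.
Proof.
elim/pres_ind=> t; elim/pres_ind=> u; elim/pres_ind=> w.
by rewrite !presE; apply/pres_classP/cong_addA.
Qed.

Fact pres_addC : commutative pres_add.
Proof.
elim/pres_ind=> t; elim/pres_ind=> u.
by rewrite !presE; apply/pres_classP/cong_addC.
Qed.

Fact pres_add0 : left_id pres_zero pres_add.
Proof. by elim/pres_ind=> t; rewrite !presE; apply/pres_classP/cong_add0. Qed.

Fact pres_addN : left_inverse pres_zero pres_opp pres_add.
Proof. by elim/pres_ind=> t; rewrite !presE; apply/pres_classP/cong_addN. Qed.

HB.instance Definition _ :=
  GRing.isZmodule.Build presented_alg pres_addA pres_addC pres_add0 pres_addN.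

Fact pres_scaleA a c x : pres_scale a (pres_scale c x) = pres_scale (a * c) x.
Proof.
by elim/pres_ind: x => t; rewrite !presE; apply/pres_classP/cong_scaleA.
Qed.

Fact pres_scale1 : left_id 1 pres_scale.
Proof. by elim/pres_ind=> t; rewrite !presE; apply/pres_classP/cong_scale1. Qed.

Fact pres_scaleDr : right_distributive pres_scale +%R.
Proof.
move=> a; elim/pres_ind=> t; elim/pres_ind=> u.
rewrite /GRing.add /= !presE; exact/pres_classP/cong_scaleDr.
Qed.

Fact pres_scaleDl x : {morph pres_scale^~ x : a c / a + c}.
Proof.
elim/pres_ind: x => t a c.
rewrite [RHS]/GRing.add /= !presE; exact/pres_classP/cong_scaleDl.
Qed.

HB.instance Definition _ := GRing.Zmodule_isLmodule.Build K presented_alg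
  pres_scaleA pres_scale1 pres_scaleDr pres_scaleDl.

Lemma pres_mulA : associative pres_mul.
Proof.
elim/pres_ind=> t; elim/pres_ind=> u; elim/pres_ind=> w.
by rewrite !presE; apply/pres_classP/cong_mulA.
Qed.

Lemma pres_mulDl : left_distributive pres_mul +%R.
Proof.
elim/pres_ind=> t; elim/pres_ind=> u; elim/pres_ind=> w.
rewrite /GRing.add /= !presE; exact/pres_classP/cong_mulDl.
Qed.

Lemma pres_mulDr : right_distributive pres_mul +%R.
Proof.
elim/pres_ind=> t; elim/pres_ind=> u; elim/pres_ind=> w.
rewrite /GRing.add /= !presE; exact/pres_classP/cong_mulDr.
Qed.

Lemma pres_scaleAl a x y : pres_mul (a *: x) y = a *: pres_mul x y.
Proof.
elim/pres_ind: x => t; elim/pres_ind: y => u.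
rewrite /GRing.scale /= !presE; exact/pres_classP/cong_scaleAl.
Qed.

Lemma pres_scaleAr a x y : pres_mul x (a *: y) = a *: pres_mul x y.
Proof.
elim/pres_ind: x => t; elim/pres_ind: y => u.
rewrite /GRing.scale /= !presE; exact/pres_classP/cong_scaleAr.
Qed.

End PresentedAlgebra.

Section UnitalPresentedAlgebra.
Variables (K : comPzRingType) (X : Type).
Variable R : alg_term K true X -> alg_term K true X -> Prop.

Definition pres_one : presented_alg R := pres_class R (TOne isT).

Fact pres_mul1l : left_id pres_one (@pres_mul _ _ _ R).
Proof.
by elim/pres_ind=> t; rewrite pres_mulE; apply/pres_classP/cong_mul1l.
Qed.

Fact pres_mul1r : right_id pres_one (@pres_mul _ _ _ R).
Proof.
by elim/pres_ind=> t; rewrite pres_mulE; apply/pres_classP/cong_mul1r.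
Qed.

HB.instance Definition _ := GRing.Zmodule_isPzRing.Build (presented_alg R)
  (@pres_mulA _ _ _ R) pres_mul1l pres_mul1r
  (@pres_mulDl _ _ _ R) (@pres_mulDr _ _ _ R).

End UnitalPresentedAlgebra.

(** * Leavitt path algebras *)

Record digraph := Digraph {
  vertex : eqType;
  edge : eqType;
  src : edge -> vertex;
  tgt : edge -> vertex
}.

Inductive lpa_gen (E : digraph) :=
| GVertex of vertex E
| GEdge of edge E
| GGhost of edge E.

Section LeavittPathAlgebra.
Variables (K : fieldType) (E : digraph).

Local Notation term := (alg_term K false (lpa_gen E)).
Local Notation "''v' x" := (TGen (GVertex x) : term) (at level 8, x at level 2).
Local Notation "''e' x" := (TGen (GEdge x) : term) (at level 8, x at level 2).
Local Notation "''g' x" := (TGen (GGhost x) : term) (at level 8, x at level 2).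

(* In [lpa_CK2] the duplicate-free sequence [l] enumerates s^-1(v), which is
   thereby assumed to be finite; it is nonempty by [l != [::]]. *)
Inductive lpa_rel : term -> term -> Prop :=
| lpa_V (v w : vertex E) :
    lpa_rel (TMul 'v v 'v w) (if v == w then 'v v else TZero)
| lpa_E1s (e : edge E) : lpa_rel (TMul 'v (src e) 'e e) 'e e
| lpa_E1r (e : edge E) : lpa_rel (TMul 'e e 'v (tgt e)) 'e e
| lpa_E2r (e : edge E) : lpa_rel (TMul 'v (tgt e) 'g e) 'g e
| lpa_E2s (e : edge E) : lpa_rel (TMul 'g e 'v (src e)) 'g e
| lpa_CK1 (e f : edge E) :
    lpa_rel (TMul 'g e 'e f) (if e == f then 'v (tgt e) else TZero)
| lpa_CK2 (v : vertex E) (l : seq (edge E)) :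
    uniq l -> (forall e, (e \in l) = (src e == v)) -> l != [::] ->
    lpa_rel 'v v (\big[TAdd/TZero]_(e <- l) TMul 'e e 'g e).

Definition leavitt_path_alg := presented_alg lpa_rel.
HB.instance Definition _ := GRing.Lmodule.on leavitt_path_alg.

Definition lpa_mul : leavitt_path_alg -> leavitt_path_alg -> leavitt_path_alg :=
  @pres_mul _ _ _ lpa_rel.

End LeavittPathAlgebra.

(* The two edges from i to i + 1 mod n are (false, i) and (true, i). *)
Definition C1graph (n : nat) : digraph :=
  @Digraph 'I_n (bool * 'I_n)%type (fun e => e.2) (fun e => ordS e.2).

(** * Leavitt algebras *)

Inductive leavitt_gen (m : nat) :=
| GX of 'I_m
| GY of 'I_m.

Inductive leavitt_rel (K : fieldType) (m : nat) :
    alg_term K true (leavitt_gen m) -> alg_term K true (leavitt_gen m) -> Prop :=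
| leavitt_YX (i k : 'I_m) :
    leavitt_rel (TMul (TGen (GY i)) (TGen (GX k)))
                (if i == k then TOne isT else TZero)
| leavitt_XY :
    leavitt_rel (\big[TAdd/TZero]_(i < m) TMul (TGen (GX i)) (TGen (GY i)))
                (TOne isT).

Definition leavitt_alg (K : fieldType) (m : nat) :=
  presented_alg (@leavitt_rel K m).
HB.instance Definition _ (K : fieldType) (m : nat) :=
  GRing.PzRing.on (leavitt_alg K m).
HB.instance Definition _ (K : fieldType) (m : nat) :=
  GRing.Lmodule.on (leavitt_alg K m).

(* The K-module structure of a matrix algebra M_d(A) over a K-algebra A acts
   entrywise; [*:%R] on ['M[A]_d] is instead the action of A itself. *)
Definition scale_mx (K : pzRingType) (A : lmodType K) (d : nat) (a : K)
    (M : 'M[A]_d) : 'M[A]_d :=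
  map_mx (GRing.scale a) M.

(* [f] is an isomorphism of (not necessarily unital) K-algebras from L_K(E)
   onto M_d(L_K(1,m)); being bijective and multiplicative, it preserves any
   unit. *)
Definition lpa_mx_iso (K : fieldType) (E : digraph) (m d : nat)
    (f : leavitt_path_alg K E -> 'M[leavitt_alg K m]_d) : Prop :=
  [/\ bijective f,
      forall x y, f (x + y) = f x + f y,
      forall (a : K) x, f (a *: x) = scale_mx a (f x)
    & forall x y, f (lpa_mul x y) = f x *m f y].

(* Main.v *)
Require Import Defs.
From mathcomp Require Import all_boot all_order all_algebra.
From HB Require Import structures.
From mathcomp Require Import zify.

Set Implicit Arguments.
Unset Strict Implicit.
Unset Printing Implicit Defensive.

Import GRing.Theory.
Local Open Scope ring_scope.

(** Let [v] be a vertex of C_n^1.  Relation (CK2) makes every vertex equivalent,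
   as an idempotent, to two copies of its successor, so the vertex at distance
   [j] before [v] is equivalent to [2 ^ j] copies of [v].  Summing over the
   distances 0 to [n - 1] gives 1 ~ (2 ^ n - 1) v, hence L ~ M_d(v L v) with
   d = 2 ^ n - 1; and going once around the cycle shows that [v L v] is
   generated by the [2 ^ n] closed paths of length [n] and their ghosts, which
   satisfy the relations of L_K(1, 2 ^ n).

   The paths ending at [v] form a binary tree: those of length [j] are numbered
   [2 ^ j, ..., 2 ^ j.+1 - 1], and prolonging the path [k] backwards by the edge
   with bit [b] gives [b + 2 k].  The paths of length less than [n] thus number
   the rows of the matrices (row [i] standing for the path [i + 1]), and the
   [2 ^ n] paths of length [n] number the generators of L_K(1, 2 ^ n).

   The record [heap_system] lists the relations between the paths [P k], their
   ghosts [Q k] and the idempotent [u] of the root [v].  Any K-algebra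
   containing a heap system receives a homomorphism from L
   ([heap_eval_model]) and one from L_K(1, 2 ^ n), with unit going to [u] ([leavitt_eval_model]).  The algebra L
   contains the heap system of its actual paths ([path_heap]); the matrix
   algebra contains one built from the matrix units of its first row and column
   and the generators of L_K(1, 2 ^ n) in its corner ([matrix_heap]).  The map
   [lpa_to_mx] is the homomorphism given by the second heap system; its inverse
   sends M to the sum of the P_i phi(M_ij) Q_j, where phi is the homomorphism
   from L_K(1, 2 ^ n) given by the first.  That both composites are identities
   is checked on generators. *)

(** * Homomorphisms out of presented algebras *)

(** A [K]-algebra structure on a ring, with the scalar multiplication as a bare
   function: on matrices over an algebra the canonical scaling belongs to the
   coefficient ring instead of to [K]. *)
Record alg_action (K B : pzRingType) (sc : K -> B -> B) : Prop := AlgAction {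
  actA : forall a c x, sc a (sc c x) = sc (a * c) x;
  act1 : forall x, sc 1 x = x;
  actDr : forall a x y, sc a (x + y) = sc a x + sc a y;
  actDl : forall a c x, sc (a + c) x = sc a x + sc c x;
  actMl : forall a x y, sc a x * y = sc a (x * y);
  actMr : forall a x y, x * sc a y = sc a (x * y)
}.

Section Evaluation.
Variables (K : comPzRingType) (b : bool) (X : Type) (B : pzRingType).
Variables (sc : K -> B -> B) (u : B) (h : X -> B).

(** The unit of the presented algebra goes to an element [u] of [B] that need
   not be 1, so that unital algebras can be mapped into a corner [u B u]. *)
Fixpoint eval (t : alg_term K b X) : B :=
  match t with
  | TGen x => h x
  | TZero => 0
  | TOne _ => u
  | TAdd t1 t2 => eval t1 + eval t2
  | TOpp t1 => - eval t1
  | TScale a t1 => sc a (eval t1)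
  | TMul t1 t2 => eval t1 * eval t2
  end.

Lemma eval_sum (I : Type) (r : seq I) (F : I -> alg_term K b X) :
  eval (\big[TAdd/TZero]_(i <- r) F i) = \sum_(i <- r) eval (F i).
Proof. by elim: r => [|i r IHr]; rewrite ?big_nil// !big_cons /= IHr. Qed.

Variable R : alg_term K b X -> alg_term K b X -> Prop.

Record eval_model : Prop := EvalModel {
  model_action : alg_action sc;
  model_idem : u * u = u;
  model_corner : b -> forall x, u * h x = h x /\ h x * u = h x;
  model_rel : forall t t', R t t' -> eval t = eval t'
}.

Definition pres_lift (x : presented_alg R) : B := eval (repr x).

Hypothesis model : eval_model.
Let act := model_action model.

Lemma eval_corner t : b -> u * eval t = eval t /\ eval t * u = eval t.
Proof.
move=> hb; elim: t => /=.
- exact: model_corner.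
- by rewrite mulr0 mul0r.
- by rewrite !model_idem.
- by move=> t [IHl IHr] t' [IHl' IHr']; rewrite mulrDr mulrDl IHl IHr IHl' IHr'.
- by move=> t [IHl IHr]; rewrite mulrN mulNr IHl IHr.
- by move=> a t [IHl IHr]; rewrite (actMr act) (actMl act) IHl IHr.
- by move=> t [IHl IHr] t' [IHl' IHr']; rewrite mulrA IHl -mulrA IHr'.
Qed.

Lemma eval_cong t t' : alg_cong R t t' -> eval t = eval t'.
Proof.
elim=> //=; clear t t'.
- exact: model_rel.
- by move=> t t' w _ -> _ ->.
- by move=> t t' w w' _ -> _ ->.
- by move=> t t' _ ->.
- by move=> a t t' _ ->.
- by move=> t t' w w' _ -> _ ->.
- by move=> *; rewrite addrA.
- by move=> *; rewrite addrC.
- by move=> *; rewrite add0r.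
- by move=> *; rewrite addNr.
- by move=> *; rewrite (actA act).
- by move=> *; rewrite (act1 act).
- by move=> *; rewrite (actDr act).
- by move=> *; rewrite (actDl act).
- by move=> *; rewrite mulrA.
- by move=> *; rewrite mulrDl.
- by move=> *; rewrite mulrDr.
- by move=> *; rewrite (actMl act).
- by move=> *; rewrite (actMr act).
- by move=> hb t; have [] := eval_corner t hb.
- by move=> hb t; have [] := eval_corner t hb.
Qed.

Lemma pres_liftE t : pres_lift (pres_class R t) = eval t.
Proof. exact/eval_cong/pres_cong_repr. Qed.

Lemma pres_lift_gen x : pres_lift (pres_gen R x) = h x.
Proof. exact: pres_liftE. Qed.

Lemma pres_lift0 : pres_lift 0 = 0.
Proof. exact: pres_liftE TZero. Qed.

Lemma pres_liftD x y : pres_lift (x + y) = pres_lift x + pres_lift y.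
Proof.
elim/pres_ind: x => t; elim/pres_ind: y => t'.
by rewrite /GRing.add /= pres_addE !pres_liftE.
Qed.

Lemma pres_liftN x : pres_lift (- x) = - pres_lift x.
Proof.
by elim/pres_ind: x => t; rewrite /GRing.opp /= pres_oppE !pres_liftE.
Qed.

Lemma pres_liftZ a x : pres_lift (a *: x) = sc a (pres_lift x).
Proof.
by elim/pres_ind: x => t; rewrite /GRing.scale /= pres_scaleE !pres_liftE.
Qed.

Lemma pres_liftM x y : pres_lift (pres_mul x y) = pres_lift x * pres_lift y.
Proof.
by elim/pres_ind: x => t; elim/pres_ind: y => t'; rewrite pres_mulE !pres_liftE.
Qed.

End Evaluation.

Lemma pres_gen_ind (K : comPzRingType) (b : bool) (X : Type)
    (R : alg_term K b X -> alg_term K b X -> Prop)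
    (P : presented_alg R -> Prop) :
  (forall x, P (pres_gen R x)) -> P 0 ->
  (forall h : b, P (pres_class R (TOne h))) ->
  (forall x y, P x -> P y -> P (x + y)) -> (forall x, P x -> P (- x)) ->
  (forall a x, P x -> P (a *: x)) ->
  (forall x y, P x -> P y -> P (pres_mul x y)) -> forall x, P x.
Proof.
move=> Pg P0 P1 PD PN PZ PM; elim/pres_ind; elim=> //.
- by move=> t Pt t' Pt'; rewrite -pres_addE; apply: PD.
- by move=> t Pt; rewrite -pres_oppE; apply: PN.
- by move=> a t Pt; rewrite -pres_scaleE; apply: PZ.
- by move=> t Pt t' Pt'; rewrite -pres_mulE; apply: PM.
Qed.

(** * Binary trees and heap systems *)

Lemma sum_nat_pick (V : nmodType) m m' (F : nat -> V) k0 : (m <= k0 < m')%N ->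
  (forall k, (m <= k < m')%N -> k != k0 -> F k = 0) ->
  \sum_(m <= k < m') F k = F k0.
Proof.
move=> lk0 F0; rewrite (bigD1_seq k0) ?mem_index_iota ?iota_uniq//=.
rewrite big_seq_cond big1 ?addr0// => k.
by rewrite mem_index_iota => /andP[]; apply: F0.
Qed.

Lemma sum_nat_double (V : nmodType) m m' (F : nat -> V) :
  \sum_(m.*2 <= k < m'.*2) F k = \sum_(m <= k < m') (F k.*2 + F k.*2.+1).
Proof.
have [lem|ltm] := leqP m m'; last by rewrite !big_geq ?leq_double // ltnW.
rewrite -(subnKC lem); elim: (m' - m)%N => [|d IHd].
  by rewrite addn0 !big_geq.
rewrite addnS doubleS big_nat_recr /=; last by lia.
rewrite big_nat_recr /=; last by lia.
by rewrite IHd [RHS]big_nat_recr ?leq_addr//= addrA.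
Qed.

Definition level j k := (2 ^ j <= k < 2 ^ j.+1)%N.

Lemma level_inj i j k : level i k -> level j k -> i = j.
Proof.
by move=> /(@trunc_log_eq 2)-/(_ isT) <- /(@trunc_log_eq 2)-/(_ isT) <-.
Qed.

Lemma level_trunc_log k : (0 < k)%N -> level (trunc_log 2 k) k.
Proof. by move=> k_gt0; rewrite /level trunc_logP ?trunc_log_ltn. Qed.

Lemma level_child (b : bool) j k : level j.+1 (b + k.*2) = level j k.
Proof. by rewrite /level !expnS; case: b; apply/idP/idP; lia. Qed.

Lemma level0 k : level 0 k = (k == 1)%N.
Proof. by rewrite /level !expnS; apply/idP/idP; lia. Qed.

Lemma child_inj (b b' : bool) k k' :
  (b + k.*2 == b' + k'.*2)%N = (b == b') && (k == k').
Proof. by case: b; case: b'; apply/idP/idP; lia. Qed.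

Lemma level_bounds j n k : (j <= n)%N -> level j k -> (0 < k < 2 ^ n.+1)%N.
Proof.
move=> jn /andP[jk kj]; have : (2 ^ j.+1 <= 2 ^ n.+1)%N by rewrite leq_exp2l.
have := expn_gt0 2 j; lia.
Qed.

Lemma level_gt1 j n k : (0 < j <= n)%N -> level j k -> (1 < k < 2 ^ n.+1)%N.
Proof.
case/andP=> j0 jn jk; have /andP[_ ->] := level_bounds jn jk; rewrite andbT.
case/andP: jk => + _; apply: leq_trans.
by rewrite -[X in (X < _)%N](expn0 2) ltn_exp2l.
Qed.

Lemma trunc_log2_le n k : (0 < k < 2 ^ n.+1)%N -> (trunc_log 2 k <= n)%N.
Proof.
case/andP=> k0 kn; have /andP[le_k _] := level_trunc_log k0.
by rewrite -ltnS -(ltn_exp2l _ _ (ltnSn 1)); apply: leq_ltn_trans le_k kn.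
Qed.

Lemma sum_level_child (V : nmodType) j (F : nat -> V) :
  \sum_(2 ^ j.+1 <= k < 2 ^ j.+2) F k =
  \sum_(2 ^ j <= k < 2 ^ j.+1) (F k.*2 + F k.*2.+1).
Proof.
have dbl i : (2 ^ i.+1 = (2 ^ i).*2)%N by rewrite expnS mul2n.
by rewrite -sum_nat_double -!dbl.
Qed.

Lemma sum_level_ord (V : nmodType) j (F : nat -> V) :
  \sum_(2 ^ j <= k < 2 ^ j.+1) F k = \sum_(i < 2 ^ j) F (2 ^ j + i)%N.
Proof.
rewrite expnS mul2n -addnn [in X in index_iota X _](esym (add0n (2 ^ j)%N)).
by rewrite big_addn addnK big_mkord; apply: eq_bigr => i _; rewrite addnC.
Qed.

(** The presentation shared by the two algebras, phrased so that it mentions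
   only paths ending at the root.  Vertex number 1 of the binary tree is the
   root, and [k] has the children [k.*2] and [k.*2.+1]; [P k] plays the path
   from [k] up to the root and [Q k] its ghost.  Nodes of levels 1 to [n] are
   pairwise orthogonal, but a node of level [n] is not orthogonal to the root:
   by [heap_sum] level [n] is the root again, which is how a finite tree
   encodes the cycle. *)
Record heap_system (n : nat) (B : pzRingType) (u : B) (P Q : nat -> B) : Prop :=
  HeapSystem {
  heap_P1 : P 1%N = u;
  heap_Q1 : Q 1%N = u;
  heap_Pu : forall k, (0 < k < 2 ^ n.+1)%N -> P k * u = P k;
  heap_uQ : forall k, (0 < k < 2 ^ n.+1)%N -> u * Q k = Q k;
  heap_QP : forall k l, (1 < k < 2 ^ n.+1)%N -> (1 < l < 2 ^ n.+1)%N ->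
    Q k * P l = if k == l then u else 0;
  heap_sum : \sum_(2 ^ n <= k < 2 ^ n.+1) P k * Q k = u
}.

Section HeapSystem.
Variables (n : nat) (B : pzRingType) (u : B) (P Q : nat -> B).
Hypothesis heap : heap_system n u P Q.

Lemma heap_idem : u * u = u.
Proof.
rewrite -{1 3}(heap_P1 heap) (heap_Pu heap)//=.
by rewrite -[X in (X < _)%N](expn0 2) ltn_exp2l.
Qed.

(** In terms of paths, (CK2) iterated expands a vertex as the sum of all p p^*
   over the paths p of a fixed length from it; multiplying by an edge prolongs
   each p. *)
Definition hvertex j := \sum_(2 ^ j <= k < 2 ^ j.+1) P k * Q k.
Definition hedge (b : bool) j :=
  \sum_(2 ^ j <= k < 2 ^ j.+1) P (b + k.*2) * Q k.
Definition hghost (b : bool) j :=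
  \sum_(2 ^ j <= k < 2 ^ j.+1) P k * Q (b + k.*2).

Lemma heap_QP_level j k l : (j <= n)%N -> level j k -> level j l ->
  Q k * P l = if k == l then u else 0.
Proof.
case: j => [_|j jn jk jl]; last first.
  by apply: (heap_QP heap); apply: (@level_gt1 j.+1).
rewrite !level0 => /eqP-> /eqP->.
by rewrite (heap_P1 heap) (heap_Q1 heap) heap_idem eqxx.
Qed.

Lemma hvertex0 : hvertex 0 = u.
Proof.
by rewrite /hvertex big_nat1 (heap_P1 heap) (heap_Q1 heap) heap_idem.
Qed.

Lemma hvertexn : hvertex n = u.
Proof. exact: heap_sum. Qed.

(** Below level [n] the root joins the orthogonal family, because by [heap_sum]
   it is a sum of nodes of level [n]. *)
Lemma heap_QP_low k l : (0 < k < 2 ^ n)%N -> (0 < l < 2 ^ n)%N ->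
  Q k * P l = if k == l then u else 0.
Proof.
move=> /andP[k0 kn] /andP[l0 ln].
have nS : (2 ^ n <= 2 ^ n.+1)%N by rewrite leq_exp2l.
have uP i : (1 < i < 2 ^ n)%N -> u * P i = 0.
  move=> iP; rewrite -(heap_sum heap) mulr_suml big_nat big1 // => m mP.
  by rewrite -mulrA (heap_QP heap) ?ifN ?mulr0 //; lia.
have Qu i : (1 < i < 2 ^ n)%N -> Q i * u = 0.
  move=> iP; rewrite -(heap_sum heap) mulr_sumr big_nat big1 // => m mP.
  by rewrite mulrA (heap_QP heap) ?ifN ?mul0r //; lia.
have [k1|k1] := leqP k 1; have [l1|l1] := leqP l 1.
- have -> : k = 1%N by lia.
  have -> : l = 1%N by lia.
  by rewrite (heap_P1 heap) (heap_Q1 heap) heap_idem.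
- have -> : k = 1%N by lia.
  by rewrite (heap_Q1 heap) uP ?ifN //; lia.
- have -> : l = 1%N by lia.
  by rewrite (heap_P1 heap) Qu ?ifN //; lia.
- by rewrite (heap_QP heap) //; lia.
Qed.

Lemma hvertex_P j k : (j <= n)%N -> level j k -> hvertex j * P k = P k.
Proof.
move=> jn jk; rewrite mulr_suml (sum_nat_pick jk) => [|l jl nlk].
  rewrite -mulrA (heap_QP_level jn) // eqxx.
  by rewrite (heap_Pu heap) ?(level_bounds jn).
by rewrite -mulrA (heap_QP_level jn) // (negPf nlk) mulr0.
Qed.

Lemma hvertex_P_neq i j k : (0 < i <= n)%N -> (0 < j <= n)%N -> i != j ->
  level j k -> hvertex i * P k = 0.
Proof.
move=> iP jP nij jk; rewrite mulr_suml big_nat big1 // => l il.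
rewrite -mulrA (heap_QP heap) ?(level_gt1 iP il) ?(level_gt1 jP jk) //.
case: eqP => [elk|]; last by rewrite mulr0.
by rewrite elk in il; rewrite (level_inj il jk) eqxx in nij.
Qed.

Lemma Q_hvertex j k : (j <= n)%N -> level j k -> Q k * hvertex j = Q k.
Proof.
move=> jn jk; rewrite mulr_sumr (sum_nat_pick jk) => [|l jl nlk].
  by rewrite mulrA (heap_QP_level jn) // eqxx (heap_uQ heap) ?(level_bounds jn).
by rewrite mulrA (heap_QP_level jn) // eq_sym (negPf nlk) mul0r.
Qed.

Lemma hedge_P b j k : (j < n)%N -> level j k ->
  hedge b j * P k = P (b + k.*2)%N.
Proof.
move=> jn jk; rewrite mulr_suml (sum_nat_pick jk) => [|l jl nlk].
  rewrite -mulrA (heap_QP_level (ltnW jn)) // eqxx (heap_Pu heap) //.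
  by apply: level_bounds jn _; rewrite level_child.
by rewrite -mulrA (heap_QP_level (ltnW jn)) // (negPf nlk) mulr0.
Qed.

Lemma Q_hghost b j k : (j < n)%N -> level j k ->
  Q k * hghost b j = Q (b + k.*2)%N.
Proof.
move=> jn jk; rewrite mulr_sumr (sum_nat_pick jk) => [|l jl nlk].
  rewrite mulrA (heap_QP_level (ltnW jn)) // eqxx (heap_uQ heap) //.
  by apply: level_bounds jn _; rewrite level_child.
by rewrite mulrA (heap_QP_level (ltnW jn)) // eq_sym (negPf nlk) mul0r.
Qed.

Lemma hghost_P (b b' : bool) i j k : (i < n)%N -> (j < n)%N -> level j k ->
  hghost b i * P (b' + k.*2)%N = if (b == b') && (i == j) then P k else 0.
Proof.
move=> ilt jlt jk.
have QP l : level i l ->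
    Q (b + l.*2)%N * P (b' + k.*2)%N = if (b == b') && (l == k) then u else 0.
  move=> il; rewrite (heap_QP heap) ?child_inj //.
  - by apply: (@level_gt1 i.+1) => //; rewrite level_child.
  - by apply: (@level_gt1 j.+1) => //; rewrite level_child.
rewrite mulr_suml; case: ifP => [/andP[/eqP eb /eqP eij]|neq].
  subst i b'; rewrite (sum_nat_pick jk) => [|l jl nlk].
    by rewrite -mulrA QP // !eqxx (heap_Pu heap) ?(level_bounds (ltnW jlt)).
  by rewrite -mulrA QP // (negPf nlk) andbF mulr0.
rewrite big_nat big1 // => l il; rewrite -mulrA QP //.
case: ifP => [/andP[eb /eqP elk]|]; last by rewrite mulr0.
by subst l; rewrite eb (level_inj il jk) eqxx in neq.
Qed.

Lemma hvertexM i j : (0 < i <= n)%N -> (0 < j <= n)%N ->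
  hvertex i * hvertex j = if i == j then hvertex i else 0.
Proof.
move=> iP jP; rewrite [X in _ * X]/hvertex mulr_sumr big_nat.
case: ifP => [/eqP eij|/negbT nij].
  subst j; rewrite [RHS]big_nat; apply: eq_bigr => k ik.
  by rewrite mulrA hvertex_P //; case/andP: iP.
by rewrite big1 // => k jk; rewrite mulrA (hvertex_P_neq _ _ nij) ?mul0r.
Qed.

Lemma hvertex_edge b j : (j < n)%N -> hvertex j.+1 * hedge b j = hedge b j.
Proof.
move=> jn; rewrite /hedge mulr_sumr big_nat [RHS]big_nat.
apply: eq_bigr => k jk.
by rewrite mulrA hvertex_P // level_child.
Qed.

Lemma hedge_vertex b j : (j < n)%N -> hedge b j * hvertex j = hedge b j.
Proof.
move=> jn; rewrite /hedge mulr_suml big_nat [RHS]big_nat.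
apply: eq_bigr => k jk.
by rewrite -mulrA Q_hvertex // ltnW.
Qed.

Lemma hghost_vertex b j : (j < n)%N -> hghost b j * hvertex j.+1 = hghost b j.
Proof.
move=> jn; rewrite /hghost mulr_suml big_nat [RHS]big_nat.
apply: eq_bigr => k jk.
by rewrite -mulrA Q_hvertex // level_child.
Qed.

Lemma hvertex_ghost b j : (j < n)%N -> hvertex j * hghost b j = hghost b j.
Proof.
move=> jn; rewrite /hghost mulr_sumr big_nat [RHS]big_nat.
apply: eq_bigr => k jk.
by rewrite mulrA hvertex_P // ltnW.
Qed.

Lemma hghost_edge b b' i j : (i < n)%N -> (j < n)%N ->
  hghost b i * hedge b' j = if (b == b') && (i == j) then hvertex i else 0.
Proof.
move=> ilt jlt; rewrite [X in _ * X]/hedge mulr_sumr big_nat.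
case: ifP => [/andP[/eqP eb /eqP eij]|neq].
  subst j b'; rewrite [RHS]big_nat; apply: eq_bigr => k ik.
  by rewrite mulrA (hghost_P _ _ ilt jlt) // !eqxx.
by rewrite big1 // => k jk; rewrite mulrA (hghost_P _ _ ilt jlt) // neq mul0r.
Qed.

Lemma hedge_ghost j : (j < n)%N ->
  hedge false j * hghost false j + hedge true j * hghost true j = hvertex j.+1.
Proof.
move=> jn; rewrite /hvertex.
rewrite sum_level_child [X in _ * X + _]/hghost [X in _ + _ * X]/hghost.
rewrite !mulr_sumr -big_split /= !big_nat; apply: eq_bigr => k jk.
by rewrite !mulrA !hedge_P.
Qed.

(** The root is vertex 0, and vertex [i] reaches it after [n - i] steps.  Vertex
   0 itself is read at level [n] rather than 0, which makes the formula
   uniform. *)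
Definition heap_gen (x : lpa_gen (C1graph n)) : B :=
  match x with
  | GVertex i => hvertex (n - i)
  | GEdge e => hedge e.1 (n - e.2.+1)
  | GGhost e => hghost e.1 (n - e.2.+1)
  end.

Lemma src_level (i : 'I_n) : (n - i = (n - i.+1).+1)%N.
Proof. by rewrite subnSK. Qed.

Lemma edge_level (i : 'I_n) : (n - i.+1 < n)%N.
Proof. by have := ltn_ord i; lia. Qed.

Lemma vertex_level (i : 'I_n) : (0 < n - i <= n)%N.
Proof. by have := ltn_ord i; lia. Qed.

(** The edges into vertex 0 are the place where the cycle closes up: they need
   the levels 0 and [n] to carry the same idempotent. *)
Lemma hvertex_tgt (i : 'I_n) : hvertex (n - ordS i) = hvertex (n - i.+1).
Proof.
rewrite /=; have := ltn_ord i; rewrite leq_eqVlt => /predU1P[ei|ltin].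
  by rewrite ei modnn subn0 subnn hvertexn hvertex0.
by rewrite modn_small.
Qed.

Lemma eq_level (i j : 'I_n) : (n - i == n - j)%N = (i == j).
Proof. by rewrite -val_eqE /=; have := ltn_ord i; have := ltn_ord j; lia. Qed.

Lemma heap_eval_model (K : fieldType) (sc : K -> B -> B) : alg_action sc ->
  eval_model sc 0 heap_gen (@lpa_rel K (C1graph n)).
Proof.
move=> act; split=> //; first exact: mulr0.
move=> t t' [v w|e|e|e|e|e f|v l Ul lE l0] /=.
- by rewrite hvertexM ?vertex_level // eq_level; case: eqP.
- by rewrite src_level hvertex_edge ?edge_level.
- by rewrite [X in _ * X]hvertex_tgt hedge_vertex ?edge_level.
- by rewrite [X in X * _]hvertex_tgt hvertex_ghost ?edge_level.
- by rewrite src_level hghost_vertex ?edge_level.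
- rewrite hghost_edge ?edge_level // -[in RHS]pair_eqE /= /pair_eq /=.
  have -> : (n - e.2.+1 == n - f.2.+1)%N = (e.2 == f.2).
    by rewrite -eq_level !src_level.
  by case: ifP => //= _; rewrite -hvertex_tgt.
- rewrite eval_sum (perm_big [:: (false, v); (true, v)]) /=; last first.
    apply: uniq_perm => // -[b i]; rewrite lE !inE /= !xpair_eqE.
    by case: b; rewrite ?andbF ?orbF.
  by rewrite !big_cons big_nil /= addr0 hedge_ghost ?edge_level // -src_level.
Qed.

End HeapSystem.

Section LeavittModel.
Variables (K : fieldType) (n : nat) (B : pzRingType) (u : B) (P Q : nat -> B).
Hypothesis heap : heap_system n u P Q.

(** The closed paths at the root of length [n] are the nodes of level [n]. *)
Definition heap_leavitt_gen (x : leavitt_gen (2 ^ n)) : B :=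
  match x with
  | GX i => P (2 ^ n + i)
  | GY i => Q (2 ^ n + i)
  end.

Lemma level_top (i : 'I_(2 ^ n)) : level n (2 ^ n + i).
Proof. by rewrite /level leq_addr expnS mul2n -addnn ltn_add2l ltn_ord. Qed.

Lemma u_P_top k : level n k -> u * P k = P k.
Proof. by move=> nk; rewrite -(hvertexn heap) (hvertex_P heap). Qed.

Lemma Q_u_top k : level n k -> Q k * u = Q k.
Proof. by move=> nk; rewrite -(hvertexn heap) (Q_hvertex heap). Qed.

Lemma leavitt_eval_model (sc : K -> B -> B) : alg_action sc ->
  eval_model sc u heap_leavitt_gen (@leavitt_rel K (2 ^ n)).
Proof.
move=> act; have bnd i := level_bounds (leqnn n) (level_top i).
split=> //.
- exact: heap_idem heap.
- move=> _ [i|i] /=.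
    by rewrite u_P_top ?level_top // (heap_Pu heap).
  by rewrite Q_u_top ?level_top // (heap_uQ heap).
- move=> t t' [i k|] /=.
    rewrite (heap_QP_level heap (leqnn n)) ?level_top // eqn_add2l.
    by rewrite val_eqE; case: eqP.
  by rewrite eval_sum -[RHS](heap_sum heap) sum_level_ord.
Qed.

End LeavittModel.

(** * The paths of the Leavitt path algebra *)

(** As C_n^1 has finitely many vertices, its Leavitt path algebra has a unit;
   this name carries the resulting ring structure. *)
Definition c1lpa (K : fieldType) (n : nat) := leavitt_path_alg K (C1graph n).
HB.instance Definition _ K n := GRing.Lmodule.on (c1lpa K n).

Section UnitalC1.
Variables (K : fieldType) (n : nat).
Local Notation L := (c1lpa K n).

Definition vgen (i : 'I_n) : L := pres_gen _ (GVertex (E := C1graph n) i).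
Definition egen (b : bool) (i : 'I_n) : L :=
  pres_gen _ (GEdge (E := C1graph n) (b, i)).
Definition ggen (b : bool) (i : 'I_n) : L :=
  pres_gen _ (GGhost (E := C1graph n) (b, i)).

Let mul : L -> L -> L := @lpa_mul K (C1graph n).

Let mulA : associative mul. Proof. exact: pres_mulA. Qed.
Let mulDl : left_distributive mul +%R. Proof. exact: pres_mulDl. Qed.
Let mulDr : right_distributive mul +%R. Proof. exact: pres_mulDr. Qed.

Let mul0l x : mul 0 x = 0.
Proof. by apply: (@addrI _ (mul 0 x)); rewrite -mulDl !addr0. Qed.
Let mul0r x : mul x 0 = 0.
Proof. by apply: (@addrI _ (mul x 0)); rewrite -mulDr !addr0. Qed.

Let gen_rel t1 t2 t : @lpa_rel K (C1graph n) (TMul t1 t2) t ->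
  mul (pres_class _ t1) (pres_class _ t2) = pres_class _ t.
Proof.
by move=> r; rewrite /mul /lpa_mul pres_mulE; apply/pres_classP/cong_rel.
Qed.

Let vvE v w : mul (vgen v) (vgen w) = if v == w then vgen v else 0.
Proof. by rewrite (gen_rel (lpa_V _ _ _)) /=; case: eqP. Qed.

Let veE b i : mul (vgen i) (egen b i) = egen b i.
Proof. exact: gen_rel (lpa_E1s K (E := C1graph n) (b, i)). Qed.

Let evE b i : mul (egen b i) (vgen (ordS i)) = egen b i.
Proof. exact: gen_rel (lpa_E1r K (E := C1graph n) (b, i)). Qed.

Let vgE b i : mul (vgen (ordS i)) (ggen b i) = ggen b i.
Proof. exact: gen_rel (lpa_E2r K (E := C1graph n) (b, i)). Qed.

Let gvE b i : mul (ggen b i) (vgen i) = ggen b i.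
Proof. exact: gen_rel (lpa_E2s K (E := C1graph n) (b, i)). Qed.

Definition c1one : L := \sum_(i < n) vgen i.

(** Each generator absorbs some vertex on either side, and hence the unit. *)
Let c1one_vertex i x : mul (vgen i) x = x -> mul c1one x = x.
Proof.
move=> ix; rewrite -ix mulA; congr mul.
rewrite /c1one (big_morph (mul^~ (vgen i)) (id1 := 0) (op1 := +%R)) //.
rewrite (bigD1 i) //= vvE eqxx big1 ?addr0 // => j ji.
by rewrite vvE (negPf ji).
Qed.

Let vertex_c1one i x : mul x (vgen i) = x -> mul x c1one = x.
Proof.
move=> ix; rewrite -ix -mulA; congr mul.
rewrite /c1one (big_morph (mul (vgen i)) (id1 := 0) (op1 := +%R)) //.
rewrite (bigD1 i) //= vvE eqxx big1 ?addr0 // => j ji.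
by rewrite vvE eq_sym (negPf ji).
Qed.

Lemma c1one_mul x : mul c1one x = x /\ mul x c1one = x.
Proof.
elim/pres_gen_ind: x => //.
- case=> [v|[b i]|[b i]].
  + split; [apply: (@c1one_vertex v)|apply: (@vertex_c1one v)];
      by rewrite vvE eqxx.
  + split; [apply: (@c1one_vertex i)|apply: (@vertex_c1one (ordS i))].
      exact: veE.
    exact: evE.
  + split; [apply: (@c1one_vertex (ordS i))|apply: (@vertex_c1one i)].
      exact: vgE.
    exact: gvE.
- move=> x y [xl xr] [yl yr].
  by split; [rewrite (mulDr c1one x y) xl yl | rewrite (mulDl x y c1one) xr yr].
- move=> x [xl xr]; split; apply: (@addrI _ (x : L)).
    by rewrite -{1}xl -(mulDr c1one x (- x)) !subrr mul0r.
  by rewrite -{1}xr -(mulDl x (- x) c1one) !subrr mul0l.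
- move=> a x [xl xr].
  split; first by rewrite -{2}xl; exact: pres_scaleAr.
  by rewrite -{2}xr; exact: pres_scaleAl.
- move=> x y [xl xr] [yl yr].
  by split; [rewrite (mulA c1one x y) xl | rewrite -(mulA x y c1one) yr].
Qed.

HB.instance Definition _ := GRing.Zmodule_isPzRing.Build L
  (@pres_mulA _ _ _ (@lpa_rel K (C1graph n)))
  (fun x => (c1one_mul x).1) (fun x => (c1one_mul x).2)
  (@pres_mulDl _ _ _ (@lpa_rel K (C1graph n)))
  (@pres_mulDr _ _ _ (@lpa_rel K (C1graph n))).

Lemma vgenM v w : vgen v * vgen w = if v == w then vgen v else 0.
Proof. exact: vvE. Qed.

Lemma vgen_egen b i : vgen i * egen b i = egen b i.
Proof. exact: veE. Qed.

Lemma egen_vgen b i : egen b i * vgen (ordS i) = egen b i.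
Proof. exact: evE. Qed.

Lemma vgen_ggen b i : vgen (ordS i) * ggen b i = ggen b i.
Proof. exact: vgE. Qed.

Lemma ggen_vgen b i : ggen b i * vgen i = ggen b i.
Proof. exact: gvE. Qed.

Lemma ggen_egen b b' i i' : ggen b i * egen b' i' =
  if (b == b') && (i == i') then vgen (ordS i) else 0.
Proof.
apply: (etrans (gen_rel (lpa_CK1 K (E := C1graph n) (b, i) (b', i')))).
by rewrite xpair_eqE; case: ifP.
Qed.

Lemma egen_ggen i :
  vgen i = egen false i * ggen false i + egen true i * ggen true i.
Proof.
have src_i (e : bool * 'I_n) : (e \in [:: (false, i); (true, i)]) = (e.2 == i).
  by case: e => -[] j; rewrite !inE !xpair_eqE ?orbF.
have CK2 := @lpa_CK2 K (C1graph n) i [:: (false, i); (true, i)] isT src_i isT.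
have /pres_classP e := cong_rel CK2; rewrite [LHS]e.
rewrite !big_cons big_nil -!pres_addE -!pres_mulE.
change (egen false i * ggen false i + (egen true i * ggen true i + 0) =
  egen false i * ggen false i + egen true i * ggen true i).
by rewrite addr0.
Qed.

Lemma c1lpa_action : alg_action (fun (a : K) (x : L) => a *: x).
Proof.
split=> *; [exact: scalerA|exact: scale1r|exact: scalerDr|exact: scalerDl
  |exact: pres_scaleAl|exact: pres_scaleAr].
Qed.

End UnitalC1.

Section PathHeap.
Variables (K : fieldType) (n' : nat).
Local Notation n := n'.+1.
Local Notation L := (c1lpa K n).

(** The vertex from which [j] steps lead to vertex 0.  The remainder brings both
   [j = 0] and [j = n] to vertex 0. *)
Definition at_level j : 'I_n := inord ((n - j) %% n).

Lemma at_levelE j : at_level j = ((n - j) %% n)%N :> nat.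
Proof. by rewrite inordK // ltn_pmod. Qed.

Lemma at_levelS j : (j < n)%N -> ordS (at_level j.+1) = at_level j.
Proof.
move=> jn; apply/val_inj; rewrite /= !at_levelE.
by rewrite (modn_small (_ : n - j.+1 < n))%N ?subnSK //; lia.
Qed.

Lemma at_level_eq i j : (0 < i <= n)%N -> (0 < j <= n)%N ->
  (at_level i == at_level j) = (i == j).
Proof.
move=> iP jP; rewrite -val_eqE /= !at_levelE !modn_small; lia.
Qed.

Definition lvertex j : L := vgen K (at_level j).
Definition ledge b j : L := egen K b (at_level j.+1).
Definition lghost b j : L := ggen K b (at_level j.+1).

Lemma lvertexM i j : lvertex i * lvertex j =
  if at_level i == at_level j then lvertex i else 0.
Proof. exact: vgenM. Qed.

Lemma lvertex_edge b j : lvertex j.+1 * ledge b j = ledge b j.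
Proof. exact: vgen_egen. Qed.

Lemma ledge_vertex b j : (j < n)%N -> ledge b j * lvertex j = ledge b j.
Proof. by move=> jn; rewrite /lvertex -at_levelS // egen_vgen. Qed.

Lemma lvertex_ghost b j : (j < n)%N -> lvertex j * lghost b j = lghost b j.
Proof. by move=> jn; rewrite /lvertex -at_levelS // vgen_ggen. Qed.

Lemma lghost_vertex b j : lghost b j * lvertex j.+1 = lghost b j.
Proof. exact: ggen_vgen. Qed.

Lemma lghost_edge b b' j : (j < n)%N ->
  lghost b j * ledge b' j = if b == b' then lvertex j else 0.
Proof.
by move=> jn; rewrite ggen_egen eqxx andbT at_levelS.
Qed.

Lemma ledge_ghost j :
  ledge false j * lghost false j + ledge true j * lghost true j = lvertex j.+1.
Proof. by rewrite -egen_ggen. Qed.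

(** Paths are recorded by a number read from its low-order bits: the parity of
   [k] selects the first edge, and [k./2] is the rest of the path. *)
Fixpoint lpath j k : L :=
  if j is j'.+1 then ledge (odd k) j' * lpath j' k./2 else lvertex 0.
Fixpoint lgpath j k : L :=
  if j is j'.+1 then lgpath j' k./2 * lghost (odd k) j' else lvertex 0.

Definition tree_path k := lpath (trunc_log 2 k) k.
Definition tree_ghost k := lgpath (trunc_log 2 k) k.

Lemma tree_pathE j k : level j k -> tree_path k = lpath j k.
Proof. by move=> /(@trunc_log_eq 2)-/(_ isT) e; rewrite /tree_path e. Qed.

Lemma tree_ghostE j k : level j k -> tree_ghost k = lgpath j k.
Proof. by move=> /(@trunc_log_eq 2)-/(_ isT) e; rewrite /tree_ghost e. Qed.

Lemma level_half j k : level j.+1 k -> level j k./2.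
Proof. by rewrite -{1}(odd_double_half k) level_child. Qed.

Lemma tree_path_child (b : bool) j k : level j k ->
  tree_path (b + k.*2) = ledge b j * tree_path k.
Proof.
move=> jk; rewrite (@tree_pathE j.+1) ?level_child // (tree_pathE jk) /=.
by rewrite oddD odd_double addbF half_bit_double; case: b.
Qed.

Lemma tree_ghost_child (b : bool) j k : level j k ->
  tree_ghost (b + k.*2) = tree_ghost k * lghost b j.
Proof.
move=> jk; rewrite (@tree_ghostE j.+1) ?level_child // (tree_ghostE jk) /=.
by rewrite oddD odd_double addbF half_bit_double; case: b.
Qed.

Lemma lpath_src j k : lvertex j * lpath j k = lpath j k.
Proof.
by case: j => [|j] /=; rewrite ?mulrA ?lvertex_edge // lvertexM eqxx.
Qed.

Lemma lpath_tgt j k : lpath j k * lvertex 0 = lpath j k.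
Proof.
by elim: j k => [|j IHj] k /=; rewrite -?mulrA ?IHj // lvertexM eqxx.
Qed.

Lemma lgpath_src j k : lgpath j k * lvertex j = lgpath j k.
Proof.
by case: j => [|j] /=; rewrite -?mulrA ?lghost_vertex // lvertexM eqxx.
Qed.

Lemma lgpath_tgt j k : lvertex 0 * lgpath j k = lgpath j k.
Proof.
by elim: j k => [|j IHj] k /=; rewrite ?mulrA ?IHj // lvertexM eqxx.
Qed.

(** (CK1) cancels the first edges if they agree, and kills the product
   otherwise. *)
Lemma lgpath_path j k l : (j <= n)%N -> level j k -> level j l ->
  lgpath j k * lpath j l = if k == l then lvertex 0 else 0.
Proof.
elim: j k l => [|j IHj] k l jn.
  by rewrite !level0 => /eqP-> /eqP->; rewrite /= lvertexM !eqxx.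
move=> jk jl /=; rewrite mulrA -[X in X * _]mulrA lghost_edge //.
rewrite -[in k == l](odd_double_half k) -[in _ == l](odd_double_half l).
rewrite child_inj.
case: eqP => _ /=; last by rewrite mulr0 mul0r.
by rewrite lgpath_src IHj ?level_half // ltnW.
Qed.

(** (CK2), applied once for every step. *)
Lemma sum_path j : (j <= n)%N ->
  \sum_(2 ^ j <= k < 2 ^ j.+1) tree_path k * tree_ghost k = lvertex j.
Proof.
elim: j => [|j IHj] jn.
  by rewrite big_nat1 (@tree_pathE 0) // (@tree_ghostE 0) //= lvertexM eqxx.
have step (b : bool) : \sum_(2 ^ j <= k < 2 ^ j.+1)
    tree_path (b + k.*2) * tree_ghost (b + k.*2) = ledge b j * lghost b j.
  transitivity (ledge b j * lvertex j * lghost b j); last first.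
    by rewrite ledge_vertex.
  rewrite -(IHj (ltnW jn)) mulr_sumr mulr_suml big_nat [RHS]big_nat.
  apply: eq_bigr => k jk.
  by rewrite (tree_path_child b jk) (tree_ghost_child b jk) !mulrA.
rewrite sum_level_child big_split /=.
by rewrite -(ledge_ghost j) -(step false) -(step true).
Qed.

Lemma lvertexn : lvertex n = lvertex 0.
Proof.
by congr vgen; apply/val_inj; rewrite /= !at_levelE subnn subn0 mod0n modnn.
Qed.

Lemma gt1_level k : (1 < k < 2 ^ n.+1)%N -> 
  exists2 j, (0 < j <= n)%N & level j k.
Proof.
move=> /andP[k1 kn]; exists (trunc_log 2 k); last exact/level_trunc_log/ltnW.
by rewrite trunc_log_gt0 k1 trunc_log2_le // (ltnW k1).
Qed.

(** Paths of different lengths in 1 to [n] start at different vertices, and this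
   is why they are orthogonal. *)
Lemma path_heap : heap_system n (lvertex 0) tree_path tree_ghost.
Proof.
split.
- by [].
- by [].
- by move=> k /andP[/level_trunc_log kl _]; rewrite (tree_pathE kl) lpath_tgt.
- by move=> k /andP[/level_trunc_log kl _]; rewrite (tree_ghostE kl) lgpath_tgt.
- move=> k l /gt1_level[i iP ik] /gt1_level[j jP jl].
  rewrite (tree_ghostE ik) (tree_pathE jl); have [eij|nij] := eqVneq i j.
    by subst j; rewrite lgpath_path //; case/andP: iP.
  rewrite -lgpath_src -lpath_src mulrA -[X in X * _]mulrA lvertexM.
  rewrite at_level_eq // (negPf nij) mulr0 mul0r; case: eqP => // ekl.
  by rewrite ekl in ik; rewrite (level_inj ik jl) eqxx in nij.
- by rewrite sum_path // lvertexn.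
Qed.

End PathHeap.

(** * The heap system of matrices *)

Section NatDelta.
Variables (A : pzRingType) (d : nat).

(** Rows and columns are numbered from 1, as the nodes of the tree are. *)
Definition nat_delta k l (a : A) : 'M[A]_d :=
  \matrix_(i, j) if (i.+1 == k) && (j.+1 == l) then a else 0.

Lemma nat_deltaM k l l' m a c : (0 < l <= d)%N ->
  nat_delta k l a * nat_delta l' m c =
  if l == l' then nat_delta k m (a * c) else 0.
Proof.
case: l => // l ld; apply/matrixP => i j; rewrite !mxE.
rewrite (bigD1 (Ordinal ld)) //= big1 ?addr0 => [|s nsl]; rewrite !mxE /=.
  rewrite eqxx andbT; case: (l.+1 =P l') => _; rewrite !mxE ?eqxx /=.
    by case: (_ == k); case: (_ == m); rewrite ?mulr0 ?mul0r.
  by rewrite mulr0.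
by rewrite eqSS (negPf (nsl : (s != l :> nat)%N)) andbF mul0r.
Qed.

Lemma nat_delta0 k l : nat_delta k l 0 = 0.
Proof. by apply/matrixP => i j; rewrite !mxE if_same. Qed.

Lemma nat_deltaD k l : {morph nat_delta k l : a c / a + c}.
Proof.
by move=> a c; apply/matrixP => i j; rewrite !mxE; case: ifP; rewrite ?addr0.
Qed.

Lemma nat_deltaN k l : {morph nat_delta k l : a / - a}.
Proof.
by move=> a; apply/matrixP => i j; rewrite !mxE; case: ifP; rewrite ?oppr0.
Qed.

Lemma nat_delta_sum k l (I : Type) (r : seq I) (F : I -> A) :
  nat_delta k l (\sum_(i <- r) F i) = \sum_(i <- r) nat_delta k l (F i).
Proof. exact: (big_morph _ (@nat_deltaD k l) (nat_delta0 k l)). Qed.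

Lemma matrix_nat_delta (M : 'M[A]_d) :
  M = \sum_(i < d) \sum_(j < d) nat_delta i.+1 j.+1 (M i j).
Proof.
apply/matrixP => i j; rewrite summxE (bigD1 i) //=.
rewrite [X in _ + X]big1 ?addr0 => [|i' ni].
  rewrite summxE (bigD1 j) //= big1 ?addr0 => [|j' nj]; rewrite !mxE ?eqxx //.
  by rewrite eqSS val_eqE eq_sym (negPf nj).
by rewrite summxE big1 // => j' _; rewrite mxE eqSS val_eqE eq_sym (negPf ni).
Qed.

End NatDelta.

Section MatrixHeap.
Variables (K : fieldType) (n : nat).
Local Notation A := (leavitt_alg K (2 ^ n)).
Local Notation d := (2 ^ n - 1)%N.

Lemma leavitt_action : alg_action (fun (a : K) (x : A) => a *: x).
Proof.
split=> *; [exact: scalerA|exact: scale1r|exact: scalerDr|exact: scalerDl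
  |exact: pres_scaleAl|exact: pres_scaleAr].
Qed.

Lemma scale_mx_action : alg_action (@scale_mx K A d).
Proof.
have act := leavitt_action.
split=> *; apply/matrixP => i j; rewrite !mxE.
- exact: scalerA.
- exact: scale1r.
- exact: scalerDr.
- exact: scalerDl.
- by rewrite scaler_sumr; apply: eq_bigr => k _; rewrite mxE (actMl act).
- by rewrite scaler_sumr; apply: eq_bigr => k _; rewrite mxE (actMr act).
Qed.

(** Indexed by all naturals, with the value 0 out of range, in order to be
   evaluated at [k - 2 ^ n]. *)
Definition xgen k : A := oapp (fun i => pres_gen _ (GX i)) 0 (insub k).
Definition ygen k : A := oapp (fun i => pres_gen _ (GY i)) 0 (insub k).

Lemma xgenE (i : 'I_(2 ^ n)) : xgen i = pres_gen _ (GX i).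
Proof. by rewrite /xgen valK. Qed.

Lemma ygenE (i : 'I_(2 ^ n)) : ygen i = pres_gen _ (GY i).
Proof. by rewrite /ygen valK. Qed.

Lemma ygen_xgen k l : (k < 2 ^ n)%N -> (l < 2 ^ n)%N ->
  ygen k * xgen l = if k == l then 1 else 0.
Proof.
move=> kn ln; rewrite -[k]/(val (Ordinal kn)) -[l]/(val (Ordinal ln)).
rewrite ygenE xgenE val_eqE; apply: (etrans (pres_mulE _ _ _)).
have /pres_classP -> := cong_rel (leavitt_YX K (Ordinal kn) (Ordinal ln)).
by case: ifP.
Qed.

Lemma sum_xgen_ygen : \sum_(k < 2 ^ n) xgen k * ygen k = 1.
Proof.
have /pres_classP e := cong_rel (leavitt_XY K (2 ^ n)).
apply: etrans e; rewrite (big_morph (pres_class _) (id1 := 0) (op1 := +%R)) //.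
  by apply: eq_bigr => k _; rewrite xgenE ygenE -pres_mulE.
by move=> t t'; rewrite -pres_addE.
Qed.

Hypothesis n_gt0 : (0 < n)%N.

(** A path of length less than [n] is the matrix unit in row [k] of the root
   column.  At level [n] the tree is back at the root, hence at row 1, and the
   generators of the Leavitt algebra tell the [2 ^ n] ways of getting there
   apart. *)
Definition mx_path k : 'M[A]_d :=
  if (k < 2 ^ n)%N then nat_delta d k 1 1
  else nat_delta d 1 1 (xgen (k - 2 ^ n)).
Definition mx_ghost k : 'M[A]_d :=
  if (k < 2 ^ n)%N then nat_delta d 1 k 1
  else nat_delta d 1 1 (ygen (k - 2 ^ n)).

Lemma exp_gt1 : (1 < 2 ^ n)%N.
Proof. by rewrite -[X in (X < _)%N](expn0 2) ltn_exp2l. Qed.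

Lemma matrix_heap : heap_system n (nat_delta d 1 1 1) mx_path mx_ghost.
Proof.
have n1 := exp_gt1; have d1 : (0 < 1 <= d)%N by lia.
have dE : (2 ^ n.+1 = 2 ^ n + 2 ^ n)%N by rewrite expnS mul2n addnn.
split.
- by rewrite /mx_path n1.
- by rewrite /mx_ghost n1.
- move=> k _; rewrite /mx_path.
  by case: ifP => _; rewrite nat_deltaM // eqxx mulr1.
- move=> k _; rewrite /mx_ghost.
  by case: ifP => _; rewrite nat_deltaM // eqxx mul1r.
- move=> k l kP lP; rewrite /mx_path /mx_ghost.
  case: (ltnP k (2 ^ n)) => kn; case: (ltnP l (2 ^ n)) => ln.
  + by rewrite nat_deltaM ?mul1r //; lia.
  + by rewrite nat_deltaM ?ifN //; lia.
  + by rewrite nat_deltaM // !ifN //; lia.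
  + rewrite nat_deltaM // eqxx ygen_xgen; try lia.
    have -> : (k - 2 ^ n == l - 2 ^ n)%N = (k == l) by lia.
    by case: ifP; rewrite ?nat_delta0.
- rewrite -sum_xgen_ygen nat_delta_sum sum_level_ord.
  apply: eq_bigr => i _; rewrite /mx_path /mx_ghost ltnNge leq_addr /= addKn.
  by rewrite nat_deltaM.
Qed.

End MatrixHeap.

(** * The isomorphism *)

Section Isomorphism.
Variables (K : fieldType) (n' : nat).
Local Notation n := n'.+1.
Local Notation L := (c1lpa K n).
Local Notation A := (leavitt_alg K (2 ^ n)).
Local Notation d := (2 ^ n - 1)%N.
Local Notation P := (@tree_path K n').
Local Notation Q := (@tree_ghost K n').
Local Notation u := (lvertex K n' 0).

Let hL := path_heap K n'.
Let hM := matrix_heap K (ltn0Sn n').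
Let modelF := heap_eval_model hM (@scale_mx_action K n).
Let modelA := leavitt_eval_model hL (c1lpa_action K n).

Definition lpa_to_mx : L -> 'M[A]_d :=
  pres_lift (@scale_mx K A d) 0 (heap_gen (mx_path K n) (mx_ghost K n))
    (R := @lpa_rel K (C1graph n)).

Definition leavitt_to_corner : A -> L :=
  pres_lift (fun (a : K) (x : L) => a *: x) u (heap_leavitt_gen (n := n) P Q)
    (R := @leavitt_rel K (2 ^ n)).

Definition mx_to_lpa (M : 'M[A]_d) : L :=
  \sum_(i < d) \sum_(j < d) P i.+1 * leavitt_to_corner (M i j) * Q j.+1.

Local Notation f := lpa_to_mx.
Local Notation phi := leavitt_to_corner.
Local Notation g := mx_to_lpa.

Lemma lpa_to_mxD : {morph f : x y / x + y}.
Proof. exact: pres_liftD modelF. Qed.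

Lemma lpa_to_mxZ a : {morph f : x / a *: x >-> scale_mx a x}.
Proof. exact: pres_liftZ modelF a. Qed.

Lemma lpa_to_mxM : {morph f : x y / x * y}.
Proof. exact: pres_liftM modelF. Qed.

Lemma lpa_to_mx0 : f 0 = 0.
Proof. exact: pres_lift0 modelF. Qed.

Lemma lpa_to_mxN : {morph f : x / - x}.
Proof. exact: pres_liftN modelF. Qed.

Lemma cornerD : {morph phi : x y / x + y}.
Proof. exact: pres_liftD modelA. Qed.

Lemma cornerZ a : {morph phi : x / a *: x}.
Proof. exact: pres_liftZ modelA a. Qed.

Lemma cornerM : {morph phi : x y / x * y}.
Proof. exact: pres_liftM modelA. Qed.

Lemma corner0 : phi 0 = 0.
Proof. exact: pres_lift0 modelA. Qed.

Lemma cornerN : {morph phi : x / - x}.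
Proof. exact: pres_liftN modelA. Qed.

Lemma corner1 : phi 1 = u.
Proof. exact: pres_liftE modelA (TOne isT). Qed.

Lemma corner_gen x : phi (pres_gen _ x) = heap_leavitt_gen (n := n) P Q x.
Proof. exact: pres_lift_gen modelA x. Qed.

Lemma corner_sum (I : Type) (r : seq I) (F : I -> A) :
  phi (\sum_(i <- r) F i) = \sum_(i <- r) phi (F i).
Proof. exact: (big_morph _ cornerD corner0). Qed.

Lemma lpa_to_mx_sum (I : Type) (r : seq I) (F : I -> L) :
  f (\sum_(i <- r) F i) = \sum_(i <- r) f (F i).
Proof. exact: (big_morph _ lpa_to_mxD lpa_to_mx0). Qed.

Lemma mul_u_corner a : u * phi a = phi a.
Proof. by rewrite -corner1 -cornerM mul1r. Qed.

Lemma mul_corner_u a : phi a * u = phi a.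
Proof. by rewrite -corner1 -cornerM mulr1. Qed.

Lemma mx_to_lpaD : {morph g : M N / M + N}.
Proof.
move=> M N; rewrite /g -big_split; apply: eq_bigr => i _.
rewrite -big_split; apply: eq_bigr => j _ /=.
by rewrite mxE cornerD mulrDr mulrDl.
Qed.

Lemma mx_to_lpa0 : g 0 = 0.
Proof. by apply: (@addrI _ (g 0)); rewrite -mx_to_lpaD !addr0. Qed.

Lemma mx_to_lpaN : {morph g : M / - M}.
Proof.
by move=> M; apply: (@addrI _ (g M)); rewrite -mx_to_lpaD !subrr mx_to_lpa0.
Qed.

Lemma mx_to_lpa_sum (I : Type) (r : seq I) (F : I -> 'M[A]_d) :
  g (\sum_(i <- r) F i) = \sum_(i <- r) g (F i).
Proof. exact: (big_morph _ mx_to_lpaD mx_to_lpa0). Qed.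

Lemma mx_to_lpaZ a M : g (scale_mx a M) = a *: g M.
Proof.
rewrite /g scaler_sumr; apply: eq_bigr => i _.
rewrite scaler_sumr; apply: eq_bigr => j _.
by rewrite mxE cornerZ (actMr (c1lpa_action K n)) (actMl (c1lpa_action K n)).
Qed.

Lemma tree_ghost_path_ord (i j : 'I_d) :
  Q i.+1 * P j.+1 = if i == j then u else 0.
Proof.
rewrite (heap_QP_low hL) ?eqSS //; have := ltn_ord i; have := ltn_ord j; lia.
Qed.

(** The paths [P i.+1] and ghosts [Q j.+1] behave as the first column and row of
   a system of matrix units. *)
Lemma mx_to_lpaM : {morph g : M N / M * N}.
Proof.
move=> M N; rewrite /g mulr_suml; apply: eq_bigr => i _.
transitivity (\sum_(j < d) \sum_(k < d)
  P i.+1 * phi (M i k) * phi (N k j) * Q j.+1).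
  apply: eq_bigr => j _; rewrite mxE corner_sum mulr_sumr mulr_suml.
  by apply: eq_bigr => k _; rewrite cornerM !mulrA.
rewrite exchange_big mulr_suml; apply: eq_bigr => k _.
rewrite mulr_sumr [RHS](bigD1 k) //=.
rewrite [X in _ + X]big1 ?addr0 => [|l nlk]; last first.
  rewrite mulr_sumr big1 // => j _; rewrite -!mulrA (mulrA (Q _)).
  by rewrite tree_ghost_path_ord eq_sym (negPf nlk) mul0r !mulr0.
rewrite mulr_sumr; apply: eq_bigr => j _.
rewrite -!mulrA (mulrA (Q _)) tree_ghost_path_ord eqxx.
by rewrite !mulrA -(mulrA _ u) mul_u_corner.
Qed.

Lemma mx_to_lpa_delta k l a : (0 < k < 2 ^ n)%N -> (0 < l < 2 ^ n)%N ->
  g (nat_delta d k l a) = P k * phi a * Q l.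
Proof.
case: k => // k kn; case: l => // l ln.
have kd : (k < d)%N by lia.
have ld : (l < d)%N by lia.
rewrite /g (bigD1 (Ordinal kd)) //= [X in _ + X]big1 ?addr0 => [|i ni].
  rewrite (bigD1 (Ordinal ld)) //= [X in _ + X]big1 ?addr0 => [|j nj].
    by rewrite mxE !eqxx.
  rewrite mxE (_ : (j.+1 == l.+1) = false); last exact/negbTE.
  by rewrite andbF corner0 mulr0 mul0r.
rewrite big1 // => j _.
rewrite mxE (_ : (i.+1 == k.+1) = false); last exact/negbTE.
by rewrite corner0 mulr0 mul0r.
Qed.

Lemma mx_to_lpa_path k : (0 < k < 2 ^ n.+1)%N -> g (mx_path K n k) = P k.
Proof.
move=> kP; have n1 := exp_gt1 (ltn0Sn n'); rewrite /mx_path; case: ltnP => kn.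
  rewrite mx_to_lpa_delta ?corner1; [|lia..].
  by rewrite (heap_Q1 hL) !(heap_Pu hL).
rewrite mx_to_lpa_delta; [|lia..].
have kn' : (k - 2 ^ n < 2 ^ n)%N.
  by move: kP; rewrite [(2 ^ n.+1)%N]expnS; lia.
rewrite -[(k - 2 ^ n)%N]/(val (Ordinal kn')) xgenE.
rewrite (heap_P1 hL) (heap_Q1 hL) mul_u_corner mul_corner_u.
by rewrite corner_gen /= subnKC.
Qed.

Lemma mx_to_lpa_ghost k : (0 < k < 2 ^ n.+1)%N -> g (mx_ghost K n k) = Q k.
Proof.
move=> kP; have n1 := exp_gt1 (ltn0Sn n'); rewrite /mx_ghost; case: ltnP => kn.
  rewrite mx_to_lpa_delta ?corner1; [|lia..].
  by rewrite (heap_P1 hL) -mulrA !(heap_uQ hL).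
rewrite mx_to_lpa_delta; [|lia..].
have kn' : (k - 2 ^ n < 2 ^ n)%N.
  by move: kP; rewrite [(2 ^ n.+1)%N]expnS; lia.
rewrite -[(k - 2 ^ n)%N]/(val (Ordinal kn')) ygenE.
rewrite (heap_P1 hL) (heap_Q1 hL) mul_u_corner mul_corner_u.
by rewrite corner_gen /= subnKC.
Qed.

Lemma at_level_src (i : 'I_n) : at_level n' (n - i) = i.
Proof.
by apply/val_inj; rewrite /= at_levelE subKn ?modn_small //; apply: ltnW.
Qed.

Lemma lpa_to_mx_vgen v :
  f (vgen K v) = hvertex (mx_path K n) (mx_ghost K n) (n - v).
Proof. exact: pres_lift_gen modelF _. Qed.

Lemma lpa_to_mx_egen b i :
  f (egen K b i) = hedge (mx_path K n) (mx_ghost K n) b (n - i.+1).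
Proof. exact: pres_lift_gen modelF _. Qed.

Lemma lpa_to_mx_ggen b i :
  f (ggen K b i) = hghost (mx_path K n) (mx_ghost K n) b (n - i.+1).
Proof. exact: pres_lift_gen modelF _. Qed.

Lemma lpa_to_mx_ledge b j : (j < n)%N ->
  f (ledge K n' b j) = hedge (mx_path K n) (mx_ghost K n) b j.
Proof.
move=> jn; rewrite lpa_to_mx_egen at_levelE modn_small; last by lia.
by congr hedge; lia.
Qed.

Lemma lpa_to_mx_lghost b j : (j < n)%N ->
  f (lghost K n' b j) = hghost (mx_path K n) (mx_ghost K n) b j.
Proof.
move=> jn; rewrite lpa_to_mx_ggen at_levelE modn_small; last by lia.
by congr hghost; lia.
Qed.

Lemma lpa_to_mx_root : f u = nat_delta d 1 1 1.
Proof.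
rewrite lpa_to_mx_vgen at_levelE subn0 modnn subn0.
exact: hvertexn hM.
Qed.

(** The homomorphism defined by a heap system maps the paths of the algebra onto
   that heap system, since prolonging a path is multiplying by an edge. *)
Lemma lpa_to_mx_path_level j k : (j <= n)%N -> level j k ->
  f (P k) = mx_path K n k /\ f (Q k) = mx_ghost K n k.
Proof.
elim: j k => [|j IHj] k jn.
  rewrite level0 => /eqP->.
  by rewrite (heap_P1 hL) (heap_Q1 hL) (heap_P1 hM) (heap_Q1 hM) lpa_to_mx_root.
move=> /level_half jk; have [IHP IHQ] := IHj _ (ltnW jn) jk.
rewrite -(odd_double_half k) (tree_path_child K n' (odd k) jk).
rewrite (tree_ghost_child K n' (odd k) jk) !lpa_to_mxM.
rewrite lpa_to_mx_ledge // lpa_to_mx_lghost // IHP IHQ.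
by rewrite (hedge_P hM) // (Q_hghost hM).
Qed.

Lemma lpa_to_mx_path k : (0 < k < 2 ^ n.+1)%N ->
  f (P k) = mx_path K n k /\ f (Q k) = mx_ghost K n k.
Proof.
move=> kP; apply: lpa_to_mx_path_level (trunc_log2_le kP) _.
by case/andP: kP => /level_trunc_log.
Qed.

(** On generators: a vertex or an edge is expanded into products P_k Q_l by
   (CK2), and both maps preserve these. *)
Lemma lpa_to_mxK : cancel f g.
Proof.
elim/pres_gen_ind => //.
- case=> [v|[b i]|[b i]].
  + rewrite -[pres_gen _ _]/(vgen K v) lpa_to_mx_vgen mx_to_lpa_sum.
    transitivity (lvertex K n' (n - v)); last by rewrite /lvertex at_level_src.
    rewrite -sum_path ?leq_subr // big_nat [RHS]big_nat; apply: eq_bigr => k kl.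
    have kP := level_bounds (leq_subr _ _) kl.
    by rewrite mx_to_lpaM mx_to_lpa_path // mx_to_lpa_ghost.
  + rewrite -[pres_gen _ _]/(egen K b i) lpa_to_mx_egen mx_to_lpa_sum.
    transitivity (ledge K n' b (n - i.+1)); last first.
      by rewrite /ledge -src_level at_level_src.
    rewrite -[RHS]ledge_vertex ?edge_level //.
    rewrite -sum_path ?(ltnW (edge_level i)) //.
    rewrite mulr_sumr big_nat [RHS]big_nat; apply: eq_bigr => k kl.
    have kP := level_bounds (ltnW (edge_level i)) kl.
    have kcP : (0 < b + k.*2 < 2 ^ n.+1)%N.
      by apply: (level_bounds (edge_level i)); rewrite level_child.
    rewrite mx_to_lpaM mx_to_lpa_path // mx_to_lpa_ghost //.
    by rewrite (tree_path_child K n' b kl) mulrA.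
  + rewrite -[pres_gen _ _]/(ggen K b i) lpa_to_mx_ggen mx_to_lpa_sum.
    transitivity (lghost K n' b (n - i.+1)); last first.
      by rewrite /lghost -src_level at_level_src.
    rewrite -[RHS]lvertex_ghost ?edge_level //.
    rewrite -sum_path ?(ltnW (edge_level i)) //.
    rewrite mulr_suml big_nat [RHS]big_nat; apply: eq_bigr => k kl.
    have kP := level_bounds (ltnW (edge_level i)) kl.
    have kcP : (0 < b + k.*2 < 2 ^ n.+1)%N.
      by apply: (level_bounds (edge_level i)); rewrite level_child.
    rewrite mx_to_lpaM mx_to_lpa_path // mx_to_lpa_ghost //.
    by rewrite (tree_ghost_child K n' b kl) mulrA.
- exact: etrans (congr1 g lpa_to_mx0) mx_to_lpa0.
- by move=> x y IHx IHy; rewrite (lpa_to_mxD x y) mx_to_lpaD IHx IHy.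
- by move=> x IHx; rewrite (lpa_to_mxN x) mx_to_lpaN IHx.
- by move=> a x IHx; rewrite (lpa_to_mxZ a x) mx_to_lpaZ IHx.
- by move=> x y IHx IHy; rewrite (lpa_to_mxM x y) mx_to_lpaM IHx IHy.
Qed.

(** The corner of the Leavitt path algebra at the root is sent to the top left
   entry; by multiplicativity it is enough to look at the generators. *)
Lemma lpa_to_mx_corner a : f (phi a) = nat_delta d 1 1 a.
Proof.
have n1 := exp_gt1 (ltn0Sn n'); have d1 : (0 < 1 <= d)%N by lia.
elim/pres_gen_ind: a.
- case=> i; rewrite corner_gen /=.
    rewrite (lpa_to_mx_path (level_bounds (leqnn _) (level_top i))).1 /mx_path.
    by rewrite ltnNge leq_addr /= addKn xgenE.
  rewrite (lpa_to_mx_path (level_bounds (leqnn _) (level_top i))).2 /mx_ghost.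
  by rewrite ltnNge leq_addr /= addKn ygenE.
- by rewrite corner0 lpa_to_mx0 nat_delta0.
- move=> h; rewrite (bool_irrelevance h isT).
  exact: etrans (congr1 f corner1) lpa_to_mx_root.
- by move=> x y IHx IHy; rewrite (cornerD x y) lpa_to_mxD IHx IHy -nat_deltaD.
- by move=> x IHx; rewrite (cornerN x) lpa_to_mxN IHx -nat_deltaN.
- move=> a x IHx; rewrite (cornerZ a x) lpa_to_mxZ IHx; apply/matrixP => i j.
  by rewrite !mxE; case: ifP => // _; apply: scaler0.
- move=> x y IHx IHy.
  by rewrite (cornerM x y) lpa_to_mxM IHx IHy nat_deltaM // eqxx.
Qed.

Lemma mx_to_lpaK : cancel g f.
Proof.
have n1 := exp_gt1 (ltn0Sn n'); have d1 : (0 < 1 <= d)%N by lia.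
move=> M; rewrite [RHS]matrix_nat_delta /g lpa_to_mx_sum; apply: eq_bigr => i _.
rewrite lpa_to_mx_sum; apply: eq_bigr => j _.
rewrite !lpa_to_mxM lpa_to_mx_corner.
have ordP (k : 'I_d) : (0 < k.+1 < 2 ^ n)%N by have := ltn_ord k; lia.
have nS : (2 ^ n <= 2 ^ n.+1)%N by rewrite leq_exp2l.
rewrite (lpa_to_mx_path (_ : 0 < i.+1 < 2 ^ n.+1)%N).1; last first.
  by have := ordP i; lia.
rewrite (lpa_to_mx_path (_ : 0 < j.+1 < 2 ^ n.+1)%N).2; last first.
  by have := ordP j; lia.
rewrite /mx_path /mx_ghost.
case/andP: (ordP i) => _ ->; case/andP: (ordP j) => _ ->.
by rewrite !nat_deltaM // !eqxx mulr1 mul1r.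
Qed.

End Isomorphism.

Theorem proposition3p4 (K : fieldType) (n : nat) (n_gt0 : (0 < n)%N) :
  exists f : leavitt_path_alg K (C1graph n) ->
             'M[leavitt_alg K (2 ^ n)]_(2 ^ n - 1),
    lpa_mx_iso f.
Proof.
case: n n_gt0 => // n' _; exists (@lpa_to_mx K n'); split.
- exact: Bijective (@lpa_to_mxK K n') (@mx_to_lpaK K n').
- exact: lpa_to_mxD.
- exact: lpa_to_mxZ.
- exact: lpa_to_mxM.
Qed.
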